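(* Let $G=(V,E)$ be an undirected graph with $|V|=n$ and $|E|=m$, and let $k\ge 1$ be an integer. (ILP) There exists an ILP formulation with $O(n^2)$ variables and $O(n\cdot m)$ constraints that has a solution if and only if $G$ has bandwidth $\le k$. (SAT) There exists a SAT formulation with $O(n^2)$ variables and $O(n^3)$ clauses of maximum size $n$ that has a solution if and only if $G$ has bandwidth $\le k$.
   Context: The bandwidth of $G$ is $bw(G)=\min_f\max\{f(v)-f(u) : uv\in E \text{ and } f(u)<f(v)\}$, where $f$ ranges over all bijections $f:V\to\{1,\dots,n\}$. An ILP formulation is an integer linear program associated with the input (here $G$ and $k$); having a solution means that its feasible region is non-empty. A SAT formulation is a set of Boolean clauses associated with the same input; its solutions are the satisfying assignments. The size of a clause is its number of literals. *)

(* Defs.v *)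
From HB Require Import structures.
From mathcomp Require Import all_boot all_order all_algebra.

Set Implicit Arguments.
Unset Strict Implicit.
Unset Printing Implicit Defensive.

Record sgraph (V : finType) := SGraph {
  adj : rel V;
  adj_sym : symmetric adj;
  adj_irr : irreflexive adj
}.

Definition edges (V : finType) (G : sgraph V) : {set {set V}} :=
  [set [set uv.1; uv.2] | uv : V * V & adj G uv.1 uv.2].

Definition order_of (V : finType) (G : sgraph V) : nat := #|V|.
Definition size_of (V : finType) (G : sgraph V) : nat := #|edges G|.

(* Positions are numbered 0, ..., n-1 instead of 1, ..., n; only differences
   of positions are ever used. *)
Definition bijectiveb (V : finType) (f : {ffun V -> 'I_#|V|}) : bool :=
  injectiveb f && [forall i, exists v, f v == i].

(* An empty maximum is 0, so an edgeless graph has bandwidth 0. *)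
Definition layout_width (V : finType) (G : sgraph V)
    (f : {ffun V -> 'I_#|V|}) : nat :=
  \max_(uv : V * V | adj G uv.1 uv.2 && (f uv.1 < f uv.2))
    (f uv.2 - f uv.1).

(* The enumeration order only witnesses that the minimum ranges over a
   nonempty set; see [bandwidth_attained] and [bandwidth_min]. *)
Definition bandwidth (V : finType) (G : sgraph V) : nat :=
  layout_width G
    [arg min_(f < [ffun v : V => enum_rank v] | bijectiveb f)
       layout_width G f].

Lemma bijectiveb_enum_rank (V : finType) :
  bijectiveb [ffun v : V => enum_rank v].
Proof.
apply/andP; split.
  by apply/injectiveP => u v; rewrite !ffunE => /enum_rank_inj.
apply/forallP => i; apply/existsP; exists (enum_val i).
by rewrite ffunE enum_valK.
Qed.

Lemma bandwidth_attained (V : finType) (G : sgraph V) :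
  exists2 f : {ffun V -> 'I_#|V|}, bijectiveb f & bandwidth G = layout_width G f.
Proof.
rewrite /bandwidth; case: arg_minnP => [|f bf _]; first exact: bijectiveb_enum_rank.
by exists f.
Qed.

Lemma bandwidth_min (V : finType) (G : sgraph V) (f : {ffun V -> 'I_#|V|}) :
  bijectiveb f -> bandwidth G <= layout_width G f.
Proof.
rewrite /bandwidth; case: arg_minnP => [|g _ ming]; first exact: bijectiveb_enum_rank.
exact: ming.
Qed.

(* The constraint (a, b) stands for a x <= b. *)
Definition lin_constraint (v : nat) : Type := ('rV[int]_v * int)%type.

Definition lin_satisfies (v : nat) (x : 'cV[int]_v) (c : lin_constraint v) :
    bool :=
  ((c.1 *m x) ord0 ord0 <= c.2)%R.

(* maximize the objective over the integral x satisfying all constraints.  The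
   variables are free: bounds and sign restrictions count as constraints. *)
Record ilp := ILP {
  ilp_vars : nat;
  ilp_objective : 'rV[int]_ilp_vars;
  ilp_constraints : seq (lin_constraint ilp_vars)
}.

Definition ilp_feasible (P : ilp) (x : 'cV[int]_(ilp_vars P)) : bool :=
  all (lin_satisfies x) (ilp_constraints P).

Definition ilp_has_solution (P : ilp) : Prop :=
  exists x : 'cV[int]_(ilp_vars P), ilp_feasible x.

(* (x, true) is the literal x, (x, false) its negation. *)
Definition literal (v : nat) : finType := ('I_v * bool)%type.
Definition clause (v : nat) : finType := {set literal v}.

Record cnf := CNF {
  cnf_vars : nat;
  cnf_clauses : {set clause cnf_vars}
}.

Definition cnf_satisfies (S : cnf) (a : 'I_(cnf_vars S) -> bool) : Prop :=
  forall c, c \in cnf_clauses S -> exists2 l, l \in c & a l.1 = l.2.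

Definition cnf_has_solution (S : cnf) : Prop :=
  exists a : 'I_(cnf_vars S) -> bool, cnf_satisfies a.

(* A formulation has to be written down from G and k, not from the answer: an
   arbitrary map from inputs to programs could return a fixed feasible or a
   fixed infeasible program according to whether bw(G) <= k.  Hence a
   formulation is a scheme: constraints depending on V and k only, together
   with constraints imposed "for every edge uv", which depend on V, k, u, v. *)
Record ilp_formulation := ILPFormulation {
  ilpf_vars : finType -> nat -> nat;
  ilpf_objective : forall (V : finType) (k : nat), 'rV[int]_(ilpf_vars V k);
  ilpf_common : forall (V : finType) (k : nat),
    seq (lin_constraint (ilpf_vars V k));
  ilpf_edge : forall (V : finType) (k : nat), V -> V ->
    seq (lin_constraint (ilpf_vars V k))
}.

(* An edge is visited in both orientations, and repeated constraints count
   repeatedly. *)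
Definition ilp_of (F : ilp_formulation) (V : finType) (G : sgraph V) (k : nat) :
    ilp :=
  @ILP (ilpf_vars F V k) (ilpf_objective F V k)
    (ilpf_common F V k ++
     flatten [seq ilpf_edge F k uv.1 uv.2
             | uv <- enum [pred uv : V * V | adj G uv.1 uv.2]]).

Record sat_formulation := SATFormulation {
  satf_vars : finType -> nat -> nat;
  satf_common : forall (V : finType) (k : nat), {set clause (satf_vars V k)};
  satf_edge : forall (V : finType) (k : nat), V -> V ->
    {set clause (satf_vars V k)}
}.

Definition cnf_of (F : sat_formulation) (V : finType) (G : sgraph V) (k : nat) :
    cnf :=
  @CNF (satf_vars F V k)
    (satf_common F V k :|:
     \bigcup_(uv : V * V | adj G uv.1 uv.2) satf_edge F k uv.1 uv.2).

(* Main.v *)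
(* ILP: an integer for each ordered pair of vertices [u], [w] decides which of
   them comes first (big-M constraints), so that the position of [u] differs
   from all the others.  Within O(n m), constraints on [u] can only be charged
   to an edge at [u]; hence the order of two isolated vertices stays
   unconstrained, and they are placed afterwards in the free positions.
   SAT: the variable [(u, i)] says that [u] has position [i].  An edge [uv]
   contributes, for each [i], the clause "if [u] is at [i], then [v] is at some
   [j] with [0 < |i - j| <= k]"; leaving out [j = i] keeps its size at most [n].
   No clause forbids a vertex to have several positions: each of the [n]
   vertices has one and no two share one, so none of the [n] positions is
   left over. *)

Require Import Defs.
From HB Require Import structures.
From mathcomp Require Import all_boot all_order all_algebra zify.

Set Implicit Arguments.
Unset Strict Implicit.
Unset Printing Implicit Defensive.

Import Order.TTheory GRing.Theory Num.Theory.

(** * Oriented edges, layouts as injections, extension of injections *)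

Lemma card_oriented_edges (V : finType) (G : sgraph V) :
  #|[pred uv : V * V | adj G uv.1 uv.2]| <= 2 * size_of G.
Proof.
pose ends (uv : V * V) := [set uv.1; uv.2].
pose E := [set uv : V * V | adj G uv.1 uv.2].
have -> : size_of G = #|ends @: E|.
  by apply: eq_card => e; apply/imsetP/imsetP => -[p pG ->];
    exists p; rewrite ?inE in pG *.
have -> : #|[pred uv : V * V | adj G uv.1 uv.2]| = #|E| by rewrite cardsE.
(* Oriented edges are grouped by their set of ends; the fibre over [[set a; b]] holds at most
   [(a, b)] and [(b, a)]. *)
rewrite mulnC -sum_nat_const -sum1_card (partition_big_imset ends) /=.
apply: leq_sum => e /imsetP[[a b] _ ->]; rewrite sum1_card.
apply: leq_trans (_ : #|[set (a, b); (b, a)]| <= 2); last first.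
  by rewrite cards2; case: (_ != _).
apply/subset_leq_card/subsetP => -[u v] /andP[_ /eqP/setP uvab].
have := uvab u; have := uvab v; have := uvab a; have := uvab b.
rewrite !inE !xpair_eqE !eqxx /= ?orbT.
by move=> /orP[]/eqP ? /orP[]/eqP ? /esym/orP[]/eqP ? /esym/orP[]/eqP ?;
  subst; rewrite !eqxx ?orbT.
Qed.

Lemma inj_bijectiveb (V : finType) (f : {ffun V -> 'I_#|V|}) :
  injective f -> bijectiveb f.
Proof.
move=> injf; apply/andP; split; first exact/injectiveP.
apply/forallP => i; have /codomP[v ->] : i \in codom f.
  by apply: inj_card_onto => //; rewrite card_ord.
by apply/existsP; exists v.
Qed.

(** The bound for [f u < f v] extends to all oriented edges because it is trivial otherwise.
    Injectivity gives bijectivity since there are as many positions as vertices. *)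
Lemma bandwidth_leP (V : finType) (G : sgraph V) (k : nat) :
  bandwidth G <= k <->
  exists2 f : {ffun V -> 'I_#|V|}, injective f &
    forall u v, adj G u v -> f v <= f u + k.
Proof.
split=> [|[f injf fk]].
  have [f /andP[/injectiveP injf _] ->] := bandwidth_attained G.
  move=> /bigmax_leqP fk; exists f => // u v uv.
  have [fuv|] := ltnP (f u) (f v); last by lia.
  by have := fk (u, v); rewrite uv fuv /= => /(_ isT); lia.
apply: leq_trans (bandwidth_min G (inj_bijectiveb injf)) _.
by apply/bigmax_leqP => -[u v] /= /andP[/fk uv _]; rewrite leq_subLR.
Qed.

(** The complements of [A] and of its image have the same size, so matching their enumerations index
    by index completes [g]. This places the isolated vertices of the ILP. *)
Lemma extend_injection (V T : finType) (A : {set V}) (g : V -> T) :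
  #|V| = #|T| -> {in A &, injective g} ->
  exists2 f : {ffun V -> T}, injective f & {in A, f =1 g}.
Proof.
move=> cardVT injg; pose B := g @: A.
have cardAB : #|~: A| = #|~: B|.
  by rewrite [LHS]cardsCs [RHS]cardsCs !setCK card_in_imset // cardVT.
(* The default [g v] only supplies an element of [T]: for [v] outside [A] the index is in range. *)
pose h v := nth (g v) (enum (~: B)) (index v (enum (~: A))).
have idx v : v \notin A -> index v (enum (~: A)) < size (enum (~: B)).
  by move=> vA; rewrite -cardE -cardAB cardE index_mem mem_enum inE.
have hB v : v \notin A -> h v \notin B.
  by move=> vA; rewrite -in_setC -mem_enum mem_nth ?idx.
exists [ffun v => if v \in A then g v else h v]; last first.
  by move=> v vA; rewrite ffunE vA.
move=> u v; rewrite !ffunE; case: ifPn => uA; case: ifPn => vA.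
- exact: injg.
- by move=> guv; have := hB v vA; rewrite -guv imset_f.
- by move=> guv; have := hB u uA; rewrite guv imset_f.
rewrite /h (set_nth_default (g v)) ?idx // => /eqP.
rewrite nth_uniq ?idx ?enum_uniq // => /eqP/(index_inj u); apply;
  by rewrite mem_enum inE.
Qed.

(** * The integer linear program *)

Section ILP.

Variables (V : finType) (k : nat).

(* [inl u] is the position of [u]; [inr (u, w)] is positive iff [u] comes
   before [w], provided [u] has a neighbour. *)
Definition ilp_var : finType := (V + V * V)%type.

Definition coord (t : ilp_var) : 'rV[int]_#|ilp_var| :=
  delta_mx ord0 (enum_rank t).

Local Open Scope ring_scope.

(** Let y be the value of [inr (u, w)]. If y >= 1, [u] must come before [w]; if y = 0, the
    constraint holds for any positions in 0, ..., n-1. *)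
Definition before_constraint (u w : V) : lin_constraint #|ilp_var| :=
  (coord (inl u) - coord (inl w) + #|V|%:Z *: coord (inr (u, w)), #|V|%:Z - 1).

(** Dually, y <= 0 forces [w] before [u], and y = 1 makes the constraint slack. *)
Definition after_constraint (u w : V) : lin_constraint #|ilp_var| :=
  (coord (inl w) - coord (inl u) - #|V|%:Z *: coord (inr (u, w)), - 1).

(** One sign of the difference suffices, as the edge is also visited as [(v, u)]. *)
Definition bw_ilp_edge (u v : V) : seq (lin_constraint #|ilp_var|) :=
  [:: (- coord (inl u), 0); (coord (inl u), #|V|%:Z - 1);
      (coord (inl v) - coord (inl u), k%:Z)]
  ++ [seq before_constraint u w | w <- enum (predC1 u)]
  ++ [seq after_constraint u w | w <- enum (predC1 u)].

Definition value (x : 'cV[int]_#|ilp_var|) (t : ilp_var) : int :=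
  x (enum_rank t) ord0.

Lemma coordE (t : ilp_var) (x : 'cV[int]_#|ilp_var|) :
  (coord t *m x) ord0 ord0 = value x t.
Proof. by rewrite -rowE mxE. Qed.

Lemma size_bw_ilp_edge (u v : V) : (size (bw_ilp_edge u v) <= 3 * #|V|)%N.
Proof.
rewrite /= size_cat !size_map -cardE cardC1; set n := #|V|.
(* The list has 3 + 2(n - 1) = 2n + 1 entries, which is at most 3n once n >= 1. *)
have : (0 < n)%N by apply/card_gt0P; exists u.
by lia.
Qed.

Lemma bw_ilp_edgeP (u v : V) (x : 'cV[int]_#|ilp_var|) :
  let f t := value x (inl t) in
  let y w := value x (inr (u, w)) in
  reflect
    [/\ 0 <= f u, f u <= #|V|%:Z - 1, f v - f u <= k%:Z
      & forall w, w != u ->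
          f u - f w + #|V|%:Z * y w <= #|V|%:Z - 1 /\
          f w - f u - #|V|%:Z * y w <= - 1]
    (all (lin_satisfies x) (bw_ilp_edge u v)).
Proof.
move=> f y.
have evalD a b :
    ((a + b) *m x) ord0 ord0 = (a *m x) ord0 ord0 + (b *m x) ord0 ord0.
  by rewrite mulmxDl [LHS]mxE.
have evalN a : (- a *m x) ord0 ord0 = - (a *m x) ord0 ord0.
  by rewrite mulNmx [LHS]mxE.
have evalZ c a : (c *: a *m x) ord0 ord0 = c * (a *m x) ord0 ord0.
  by rewrite -scalemxAl [LHS]mxE.
pose evalE := (evalD, evalN, evalZ, coordE).
rewrite /bw_ilp_edge !all_cat !all_map /= /lin_satisfies /= !evalE oppr_le0.
rewrite andbT -!andbA.
apply: (iffP and5P) => [[? ? ? /allP hb /allP ha]|[? ? ? hw]].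
  split=> // w wu; move: (hb w) (ha w); rewrite mem_enum inE wu /= !evalE.
  by move=> /(_ isT) ? /(_ isT).
split=> //.
  by apply/allP => w; rewrite mem_enum inE /= !evalE => /hw[].
by apply/allP => w; rewrite mem_enum inE /= !evalE => /hw[].
Qed.

End ILP.

Definition bw_ilp : ilp_formulation :=
  @ILPFormulation (fun V _ => #|ilp_var V|) (fun _ _ => 0%R) (fun _ _ => [::])
    bw_ilp_edge.

Lemma vars_bw_ilp (V : finType) (G : sgraph V) (k : nat) :
  ilp_vars (ilp_of bw_ilp G k) <= 2 * order_of G ^ 2.
Proof. by rewrite /= card_sum card_prod /order_of; nia. Qed.

(** The constant 6 is 2 * 3: two orientations per edge, at most 3n constraints for each. *)
Lemma size_bw_ilp (V : finType) (G : sgraph V) (k : nat) :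
  size (ilp_constraints (ilp_of bw_ilp G k)) <= 6 * (order_of G * size_of G).
Proof.
rewrite /= size_flatten sumnE /shape -map_comp big_map big_enum /=.
apply: leq_trans
  (_ : \sum_(uv in [pred uv : V * V | adj G uv.1 uv.2]) 3 * #|V| <= _).
  by apply: leq_sum => uv _; apply: (size_bw_ilp_edge k uv.1 uv.2).
rewrite sum_nat_const.
apply: leq_trans (leq_mul (card_oriented_edges G) (leqnn _)) _.
by rewrite /order_of; nia.
Qed.

Lemma bw_ilp_feasibleP (V : finType) (G : sgraph V) (k : nat) x :
  reflect (forall u v, adj G u v -> all (lin_satisfies x) (bw_ilp_edge k u v))
    (@ilp_feasible (ilp_of bw_ilp G k) x).
Proof.
apply: (iffP allP) => [h u v uv|h c /flatten_mapP[[u v]]].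
  apply/allP => c cuv; apply/h/flatten_mapP.
  by exists (u, v); rewrite ?mem_enum.
by rewrite mem_enum => /h/allP; apply.
Qed.

Lemma bw_ilp_correct (V : finType) (G : sgraph V) (k : nat) :
  ilp_has_solution (ilp_of bw_ilp G k) <-> bandwidth G <= k.
Proof.
rewrite bandwidth_leP; split=> [[x /bw_ilp_feasibleP sol]|[f injf fk]].
  pose f u := value x (inl u).
  have {}sol u v uv := bw_ilp_edgeP k u v x (sol u v uv).
  (* The default [enum_rank u] can be taken only at isolated vertices; elsewhere the constraints put
     [f u] in range. *)
  pose g u : 'I_#|V| := insubd (enum_rank u) `|f u|%N.
  have gE u v : adj G u v -> Posz (g u) = f u.
    move=> /sol[]; rewrite -!/(f _) => f0 fn _ _.
    by rewrite val_insubd; case: ifP; lia.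
  (* Only isolated vertices may be moved here, and they lie on no edge. *)
  have [|h injh hg] := @extend_injection V 'I_#|V|
    [set u | [exists v, adj G u v]] g (esym (card_ord _)).
    move=> u w; rewrite !inE => /existsP[v uv] /existsP[t wt] guw.
    apply/eqP; apply: contraT; rewrite eq_sym => wu.
    have fuw : f u = f w by rewrite -(gE _ _ uv) -(gE _ _ wt) guw.
    have [_ _ _ /(_ w wu)[]] := sol u v uv.
    (* With equal positions the two constraints read 1 <= n y <= n - 1, impossible for an integer
       y. *)
    rewrite -!/(f _) fuw; have [] := lerP (value x (inr (u, w))) 0%R; nia.
  exists h => // u v uv; have vu : adj G v u by rewrite adj_sym.
  have [_ _ + _] := sol u v uv; rewrite -!/(f _).
  rewrite -(gE _ _ uv) -(gE _ _ vu) !hg ?inE; first by lia.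
    by apply/existsP; exists v.
  by apply/existsP; exists u.
have [p [ltp injp pk]] : exists p : V -> nat, [/\ forall u, p u < order_of G,
    injective p & forall u v, adj G u v -> p v <= p u + k].
  by exists (fun u => f u); split=> // u v /val_inj/injf.
pose val_var (t : ilp_var V) : int :=
  match t with inl u => p u | inr (u, w) => (p u < p w)%N : nat end.
pose x : 'cV[int]_#|ilp_var V| := (\col_i val_var (enum_val i))%R.
have xE t : value x t = val_var t by rewrite /value mxE enum_rankK.
exists x; apply/bw_ilp_feasibleP => u v uv; apply/bw_ilp_edgeP.
rewrite !xE /= -/(order_of G).
have puv := pk u v uv; have pu := ltp u; split; try lia.
move=> w wu; rewrite !xE /=; have pw := ltp w.
have : p u != p w by rewrite eq_sym (inj_eq injp).
by case: ltngtP => //= ? _; lia.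
Qed.

(** * The SAT formulation *)

Section SAT.

Variables (V : finType) (k : nat).

Definition sat_var : finType := (V * 'I_#|V|)%type.

Definition lit (u : V) (i : 'I_#|V|) (b : bool) : literal #|sat_var| :=
  (enum_rank ((u, i) : sat_var), b).

Definition placed_clause (u : V) : clause #|sat_var| :=
  [set lit u i true | i : 'I_#|V|].

Definition distinct_clause (t : V * V * 'I_#|V|) : clause #|sat_var| :=
  [set lit t.1.1 t.2 false; lit t.1.2 t.2 false].

Definition bw_sat_common : {set clause #|sat_var|} :=
  [set placed_clause u | u : V]
  :|: [set distinct_clause t | t : V * V * 'I_#|V| & t.1.1 != t.1.2].

Definition near_clause (u v : V) (i : 'I_#|V|) : clause #|sat_var| :=
  lit u i false
  |: [set lit v j true | j in [pred j : 'I_#|V| |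
        [&& j != i, j <= i + k & i <= j + k]]].

Definition bw_sat_edge (u v : V) : {set clause #|sat_var|} :=
  [set near_clause u v i | i : 'I_#|V|].

End SAT.

Definition bw_sat : sat_formulation :=
  @SATFormulation (fun V _ => #|sat_var V|) (fun V _ => bw_sat_common V)
    bw_sat_edge.

Lemma bw_sat_clausesP (V : finType) (G : sgraph V) (k : nat)
    (c : clause (cnf_vars (cnf_of bw_sat G k))) :
  c \in cnf_clauses (cnf_of bw_sat G k) <->
  [\/ exists u, c = placed_clause u,
      exists u v i, u != v /\ c = distinct_clause (u, v, i)
    | exists u v i, adj G u v /\ c = near_clause k u v i].
Proof.
rewrite /= !inE; split=> [/orP[/orP[]|]|].
- by move=> /imsetP[u _ ->]; apply: Or31; exists u.
- move=> /imsetP[[[u v] i]]; rewrite inE => uv ->.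
  by apply: Or32; exists u, v, i.
- by move=> /bigcupP[[u v] uv /imsetP[i _ ->]]; apply: Or33; exists u, v, i.
case=> [[u ->]|[u [v [i [uv ->]]]]|[u [v [i [uv ->]]]]].
- by rewrite imset_f.
- by rewrite [X in _ || X || _]imset_f ?inE ?orbT.
- by apply/orP; right; apply/bigcupP; exists (u, v) => //; apply: imset_f.
Qed.

Lemma card_bw_sat_clauses (V : finType) (G : sgraph V) (k : nat) :
  #|cnf_clauses (cnf_of bw_sat G k)| <= 3 * order_of G ^ 3.
Proof.
rewrite /= /bw_sat_common /order_of.
set P := imset _ _; set D := imset _ _; set E := \bigcup_(_ | _) _.
have cardVVI : #|{: V * V * 'I_#|V|}| = #|V| * #|V| * #|V|.
  by rewrite !card_prod card_ord.
have leP : #|P| <= #|V| by rewrite leq_imset_card.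
have leD : #|D| <= #|V| * #|V| * #|V|.
  by rewrite -cardVVI (leq_trans (leq_imset_card _ _)) ?max_card.
have leE : #|E| <= #|V| * #|V| * #|V|.
  (* Edge clauses are counted over all triples [(u, v, i)], which gives a bound in n alone. *)
  have /subset_leq_card/leq_trans : E \subset
      [set near_clause k t.1.1 t.1.2 t.2 | t : V * V * 'I_#|V|].
    apply/bigcupsP => -[u v] _; apply/subsetP => c /imsetP[i _ ->].
    exact: (imset_f (fun t => near_clause k t.1.1 t.1.2 t.2) (x := (u, v, i))).
  by apply; rewrite -cardVVI leq_imset_card.
apply: leq_trans (leq_card_setU _ _) (leq_trans (leq_add _ leE) _).
  exact: leq_trans (leq_card_setU _ _) (leq_add leP leD).
by set n := #|V|; rewrite expnS; nia.
Qed.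

Lemma card_bw_sat_clause (V : finType) (G : sgraph V) (k : nat) c :
  c \in cnf_clauses (cnf_of bw_sat G k) -> #|c| <= order_of G.
Proof.
have ordV : #|'I_#|V| | = #|V| by rewrite card_ord.
rewrite /order_of.
move=> /bw_sat_clausesP[[u ->]|[u [v [i [uv ->]]]]|[u [v [i [_ ->]]]]].
- by rewrite -[leqRHS]ordV leq_imset_card.
(* Two literals fit because [u] and [v] are distinct, so n >= 2. *)
- apply: leq_trans (_ : #|[set u; v]| <= _); last exact: max_card.
  by rewrite !cards2 uv; case: (_ != _).
(* The excluded position [i] pays for the negative literal. *)
- rewrite cardsU1 -[leqRHS]ordV (cardD1 i) inE.
  apply: leq_add; first by case: (_ \notin _).
  apply: leq_trans (leq_imset_card _ _) _.
  by apply/subset_leq_card/subsetP => j; rewrite !inE => /andP[-> _].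
Qed.

Lemma bw_sat_correct (V : finType) (G : sgraph V) (k : nat) :
  cnf_has_solution (cnf_of bw_sat G k) <-> bandwidth G <= k.
Proof.
rewrite bandwidth_leP; split=> [[a sat]|[f injf fk]].
  pose at_ u i := a (enum_rank ((u, i) : sat_var V)).
  have placed u : exists i, at_ u i.
    have [|_ /imsetP[i _ ->] ai] := sat (placed_clause u); last by exists i.
    by apply/bw_sat_clausesP/Or31; exists u.
  have at_inj u v i : at_ u i -> at_ v i -> u = v.
    move=> ui vi; apply/eqP; apply: contraT => uv.
    have [|l] := sat (distinct_clause (u, v, i)).
      by apply/bw_sat_clausesP/Or32; exists u, v, i.
    by rewrite !inE => /orP[]/eqP-> /=; rewrite -/(at_ _ _) ?ui ?vi.
  pose f := [ffun u => xchoose (placed u)].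
  have fP u : at_ u (f u) by rewrite ffunE; apply: xchooseP.
  have injf : injective f.
    by move=> u v fuv; apply: (at_inj _ _ (f u)); rewrite // fuv.
  (* By surjectivity [i] is the chosen position of some [w], and [at_inj] identifies [w] with [u];
     hence positions are unique. *)
  have at_f u i : at_ u i -> i = f u.
    have /andP[_ /forallP/(_ i)/existsP[w /eqP <-]] := inj_bijectiveb injf.
    by move=> /(at_inj _ _ _ (fP w)) ->.
  exists f => // u v uv.
  have [|l] := sat (near_clause k u v (f u)).
    by apply/bw_sat_clausesP/Or33; exists u, v, (f u).
  rewrite inE => /orP[/set1P ->|/imsetP[j + ->]] /=; rewrite -/(at_ _ _).
    by rewrite fP.
  by rewrite inE => /and3P[_ jk _] /at_f <-.
pose a (i : 'I_#|sat_var V|) := f (enum_val i).1 == (enum_val i).2.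
have aE u i b : a (lit u i b).1 = (f u == i) by rewrite /a enum_rankK.
exists a => c.
move=> /bw_sat_clausesP[[u ->]|[u [v [i [uv ->]]]]|[u [v [i [uv ->]]]]].
- by exists (lit u (f u) true); [apply: imset_f|rewrite aE eqxx].
- have [fui|fui] := eqVneq (f u) i.
    exists (lit v i false); first exact: set22.
    rewrite aE -fui.
    by apply: contraNF uv => /eqP/injf ->.
  by exists (lit u i false); [apply: set21|rewrite aE; apply/negbTE].
- have [fui|fui] := eqVneq (f u) i; last first.
    by exists (lit u i false); [apply: setU11|rewrite aE; apply/negbTE].
  exists (lit v (f v) true); last by rewrite aE eqxx.
  apply/setUP; right; apply: imset_f.
  rewrite inE -fui !fk ?[adj _ v u]adj_sym // !andbT.
  (* The condition [j != i] holds because [f] is injective and [G] has no loops. *)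
  by apply: contraTneq uv => /injf ->; rewrite adj_irr.
Qed.

Theorem theorem2 :
  (exists (F : ilp_formulation) (C1 C2 : nat),
     forall (V : finType) (G : sgraph V) (k : nat), 1 <= k ->
     let n := order_of G in
     let m := size_of G in
     [/\ ilp_vars (ilp_of F G k) <= C1 * n ^ 2,
         size (ilp_constraints (ilp_of F G k)) <= C2 * (n * m)
       & ilp_has_solution (ilp_of F G k) <-> bandwidth G <= k])
  /\
  (exists (F : sat_formulation) (C1 C2 : nat),
     forall (V : finType) (G : sgraph V) (k : nat), 1 <= k ->
     let n := order_of G in
     [/\ cnf_vars (cnf_of F G k) <= C1 * n ^ 2,
         #|cnf_clauses (cnf_of F G k)| <= C2 * n ^ 3,
         (forall c, c \in cnf_clauses (cnf_of F G k) -> #|c| <= n)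
       & cnf_has_solution (cnf_of F G k) <-> bandwidth G <= k]).
Proof.
split.
  exists bw_ilp, 2, 6 => V G k _ /=.
  by split; [apply: vars_bw_ilp|apply: size_bw_ilp|apply: bw_ilp_correct].
exists bw_sat, 1, 3 => V G k _ /=; split.
- by rewrite card_prod card_ord mul1n /order_of -mulnn.
- exact: card_bw_sat_clauses.
- exact: card_bw_sat_clause.
- exact: bw_sat_correct.
Qed.
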